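(* Let $\mu$ be a partition of $n$ and $\alpha$ a composition of $n$. The map $\mathcal{S}_\alpha$ maps $\mathrm{SYT}(\mu,\alpha)$ surjectively onto $\mathrm{SSYT}(\mu,\alpha)$.
   Context: For a composition $\alpha=(\alpha_1,\ldots,\alpha_k)$ of $n$ (positive integers with sum $n$), $\mathcal{A}_\alpha$ is the set partition of $[n]=\{1,\ldots,n\}$ with blocks $A_i=\{\alpha_1+\cdots+\alpha_{i-1}+1,\ldots,\alpha_1+\cdots+\alpha_i\}$. $\mathrm{SYT}(\mu,\alpha)$ is the set of standard tableaux $T$ of shape $\mu$ such that no column of $T$ contains more than one element of any block of $\mathcal{A}_\alpha$. $\mathrm{SSYT}(\mu,\alpha)$ is the set of semistandard tableaux of shape $\mu$ and content $\alpha$ (rows weakly increasing, columns strictly increasing, entry $i$ appearing exactly $\alpha_i$ times). For $1\le x\le n$, $\mathcal{S}_\alpha(x)$ is the least $i$ with $x\le\alpha_1+\cdots+\alpha_i$; for a tableau $T$ with entries in $[n]$, $\mathcal{S}_\alpha(T)$ is obtained by applying $\mathcal{S}_\alpha$ to each entry. *)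

(* Defs.v *)
From mathcomp Require Import all_boot.

Set Implicit Arguments.
Unset Strict Implicit.
Unset Printing Implicit Defensive.

Definition is_partition (n : nat) (mu : seq nat) : Prop :=
  [/\ sorted geq mu, all (ltn 0) mu & sumn mu = n].

Definition is_composition (n : nat) (alpha : seq nat) : Prop :=
  all (ltn 0) alpha /\ sumn alpha = n.

(* alpha_1 + ... + alpha_i *)
Definition psum (alpha : seq nat) (i : nat) : nat := sumn (take i alpha).

(* The block A_i, for 1 <= i <= size alpha (blocks are numbered from 1). *)
Definition block (alpha : seq nat) (i : nat) : pred nat :=
  fun x => psum alpha i.-1 < x <= psum alpha i.

(* A tableau is the list of its rows, in English notation; column j (counted
   from 0) is read from top to bottom and meets the rows longer than j. *)
Definition tableau := seq (seq nat).

Definition column (T : tableau) (j : nat) : seq nat :=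
  [seq nth 0 r j | r <- T & j < size r].

Definition standard (mu : seq nat) (T : tableau) : Prop :=
  [/\ shape T = mu,
      perm_eq (flatten T) (iota 1 (sumn mu)),
      forall r, r \in T -> sorted ltn r
    & forall j, sorted ltn (column T j)].

Definition SYT (mu alpha : seq nat) (T : tableau) : Prop :=
  standard mu T /\
  forall i j, 0 < i <= size alpha -> count (block alpha i) (column T j) <= 1.

Definition has_content (alpha : seq nat) (T : tableau) : Prop :=
  (forall x, x \in flatten T -> 0 < x <= size alpha) /\
  (forall i, 0 < i <= size alpha ->
     count_mem i (flatten T) = nth 0 alpha i.-1).

Definition SSYT (mu alpha : seq nat) (T : tableau) : Prop :=
  [/\ shape T = mu,
      has_content alpha T,
      forall r, r \in T -> sorted leq r
    & forall j, sorted ltn (column T j)].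

(* The least i with x <= alpha_1 + ... + alpha_i. The search starts at i = 0,
   where the sum is empty, so the index found is i itself, and it is at least 1
   when x is. The value (size alpha).+1 for x > sumn alpha is junk. *)
Definition Sa (alpha : seq nat) (x : nat) : nat :=
  find (fun i => x <= psum alpha i) (iota 0 (size alpha).+1).

Definition Sa_tab (alpha : seq nat) (T : tableau) : tableau :=
  map (map (Sa alpha)) T.

(* Main.v *)
Require Import Defs.
From mathcomp Require Import all_boot zify.

(** Well-definedness: [Sa alpha] is monotone and its fibre over [i] is the block
    [A_i], so applying it to a column that meets each block at most once gives
    distinct, hence strictly increasing, entries.

    Surjectivity is standardization: number the cells of a semistandard [U] by
    increasing entry, and from left to right among equal entries. Equal entries
    lie in different columns, so this is a strict order; it increases along rows
    and down columns, and the cells with entry [i] receive exactly the labels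
    in [A_i]. *)

(** * Partial sums of [alpha] and the fibres of [Sa] *)

Lemma psumS alpha i : psum alpha i.+1 = psum alpha i + nth 0 alpha i.
Proof.
rewrite /psum; case: (ltnP i (size alpha)) => hi.
  by rewrite (take_nth 0 hi) sumn_rcons.
by rewrite nth_default // addn0 !take_oversize //; apply: leqW.
Qed.

Lemma leq_psum alpha : {homo psum alpha : i j / i <= j}.
Proof.
by apply: homo_leq leq_trans _ => // i; rewrite psumS leq_addr.
Qed.

Lemma psum_le_sumn alpha i : psum alpha i <= sumn alpha.
Proof. by rewrite /psum -{2}(cat_take_drop i alpha) sumn_cat leq_addr. Qed.

Lemma leq_Sa alpha : {homo Sa alpha : x y / x <= y}.
Proof. by move=> x y lexy; apply: sub_find => i; apply: leq_trans. Qed.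

(** As partial sums increase weakly, the first one to reach [x] has index [i] exactly when the sum
    at [i] reaches [x] and the one at [i.-1] does not. *)
Lemma Sa_block alpha i x :
  0 < i <= size alpha -> (Sa alpha x == i) = block alpha i x.
Proof.
case/andP=> i0 ik; rewrite /Sa /block; set p := fun j => _.
apply/eqP/andP => [Ei | [lo hi]].
  have hp : has p (iota 0 (size alpha).+1) by rewrite has_find Ei size_iota.
  have := nth_find 0 hp; rewrite Ei nth_iota // add0n => hi; split=> //.
  have /(before_find 0) : i.-1 < find p (iota 0 (size alpha).+1).
    by rewrite Ei ltn_predL.
  rewrite nth_iota ?ltnS ?(leq_trans (leq_pred i) ik) //.
  by rewrite /p add0n ltnNge => ->.
have hp : has p (iota 0 (size alpha).+1).
  by apply/hasP; exists i => //; rewrite mem_iota.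
have flt : find p (iota 0 (size alpha).+1) < (size alpha).+1.
  by rewrite -[X in _ < X](size_iota 0) -has_find.
apply/eqP; rewrite eqn_leq; apply/andP; split.
  rewrite leqNgt; apply/negP => /(before_find 0).
  by rewrite nth_iota // add0n /p hi.
rewrite leqNgt; apply/negP => fi.
have := nth_find 0 hp; rewrite nth_iota // add0n /p => xle.
have : x <= psum alpha i.-1 by apply: leq_trans xle (leq_psum _ _ _ _); rewrite -ltnS prednK.
by rewrite leqNgt lo.
Qed.

Lemma Sa_range alpha x :
  0 < x <= sumn alpha -> 0 < Sa alpha x <= size alpha.
Proof.
case/andP=> x0 xn; apply/andP; split.
  by rewrite /Sa /= /psum take0 /= [x <= 0]leqNgt x0.
rewrite -ltnS -[X in _ < X](size_iota 0) -has_find.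
apply/hasP; exists (size alpha); first by rewrite mem_iota add0n ltnSn.
by rewrite /psum take_size.
Qed.

Lemma count_itv_iota a b n :
  count (fun x => a < x <= b) (iota 1 n) = minn b n - a.
Proof.
elim: n => [|n IH]; first by rewrite minn0.
by rewrite -[n.+1]addn1 iotaD count_cat IH /=; lia.
Qed.

Lemma column_map (f : nat -> nat) (T : tableau) j :
  column (map (map f) T) j = map f (column T j).
Proof.
rewrite /column; elim: T => //= r T IH; rewrite size_map.
by case: ifP => // hj /=; rewrite IH (nth_map 0).
Qed.

Lemma shape_map (f : nat -> nat) (T : tableau) : shape (map (map f) T) = shape T.
Proof.
by elim: T => //= r T ->; rewrite size_map.
Qed.

Lemma mem_column (T : tableau) j : {subset column T j <= flatten T}.
Proof.
move=> x /mapP [r]; rewrite mem_filter => /andP [hj rT] ->.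
by apply/flattenP; exists r; rewrite // mem_nth.
Qed.

Lemma count_Sa_block alpha i s :
  0 < i <= size alpha ->
  count_mem i (map (Sa alpha) s) = count (block alpha i) s.
Proof.
by move=> hi; rewrite count_map; apply: eq_count => x /=; rewrite Sa_block.
Qed.

Lemma SSYT_Sa_tab mu alpha T :
  sumn mu = sumn alpha ->
  SYT mu alpha T -> SSYT mu alpha (Sa_tab alpha T).
Proof.
move=> Emu [[shT permT rowT colT] blockT].
have rangeT x : x \in flatten T -> 0 < Sa alpha x <= size alpha.
  by rewrite (perm_mem permT) mem_iota => hx; apply: Sa_range; lia.
split; first by rewrite shape_map.
- split=> [x | i hi]; rewrite -map_flatten.
    by case/mapP=> y /rangeT hy ->.
  (* Since [psum alpha i] is at most [sumn alpha], no block is cut off by the end of the label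
     range, and its size telescopes to the part of index [i]. *)
  rewrite count_Sa_block // (permP permT) count_itv_iota Emu.
  have := psumS alpha i.-1; have := psum_le_sumn alpha i.
  by rewrite prednK; lia.
- move=> _ /mapP [r rT ->]; apply: homo_sorted (rowT r rT) => x y /ltnW.
  exact: leq_Sa.
(* Monotonicity gives only weak increase down a column; strictness is recovered from the absence of
   repetitions. *)
- move=> j; rewrite column_map ltn_sorted_uniq_leq; apply/andP; split.
    apply: count_mem_uniq => i; case: (boolP (i \in _)) => [hi | /count_memPn //].
    have hi' : 0 < i <= size alpha.
      by case/mapP: hi => y /mem_column /rangeT hy ->.
    apply/eqP; rewrite eqn_leq {1}count_Sa_block // blockT //=.
    by rewrite -has_count has_pred1.
  apply: homo_sorted (colT j) => x y /ltnW; exact: leq_Sa.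
Qed.

(** * Standardization by ranks of (entry, column) keys *)

Definition rank (s : seq nat) (x : nat) : nat := count (leq^~ x) s.

Lemma count_lt_rank s x : x \in s -> count (ltn^~ x) s < rank s x.
Proof.
elim: s => //= y s IH; rewrite inE /rank /= => /orP [/eqP <- | /IH].
  by rewrite ltnn leqnn add0n add1n ltnS; apply: sub_count => z /ltnW.
by rewrite /rank; case: (ltngtP y x); lia.
Qed.

Lemma ltn_rank s x y : y \in s -> x < y -> rank s x < rank s y.
Proof.
move=> /count_lt_rank ys xy; apply: leq_ltn_trans ys.
by apply: sub_count => z /leq_ltn_trans; apply.
Qed.

(** Ranks of distinct elements are distinct and lie between 1 and [size s], so by cardinality they
    exhaust that interval. *)
Lemma perm_rank s : uniq s -> perm_eq (map (rank s) s) (iota 1 (size s)).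
Proof.
move=> us.
have um : uniq (map (rank s) s).
  rewrite map_inj_in_uniq // => x y xs ys Exy.
  by case: (ltngtP x y) => // /ltn_rank lt;
    [have := lt s ys | have := lt s xs]; rewrite Exy ltnn.
have sub : {subset map (rank s) s <= iota 1 (size s)}.
  move=> _ /mapP [x xs ->]; rewrite mem_iota add1n ltnS count_size andbT.
  by apply: leq_ltn_trans (count_lt_rank _ _ xs).
have [|_ Em] := uniq_min_size um sub; first by rewrite size_iota size_map.
by apply: uniq_perm; rewrite ?iota_uniq.
Qed.

Lemma sorted_rank s t :
  {subset t <= s} -> sorted ltn t -> sorted ltn (map (rank s) t).
Proof.
move=> ts; apply: (homo_sorted_in (P := mem s)); last by apply/allP.
by move=> x y _ ys; apply: ltn_rank.
Qed.

(* Position [c] of row [r] is encoded by [r_c * m + c]; for [c < m] the order of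
   the codes is the lexicographic order on pairs (entry, column). *)
Definition key_row (m : nat) (r : seq nat) : seq nat :=
  mkseq (fun c => nth 0 r c * m + c) (size r).

Lemma key_rowK m r : size r <= m -> map (divn^~ m) (key_row m r) = r.
Proof.
move=> rm; apply: (@eq_from_nth _ 0); rewrite size_map size_mkseq // => c hc.
have cm : c < m by apply: leq_trans rm.
rewrite (nth_map 0) ?size_mkseq // nth_mkseq // divnMDl ?divn_small ?addn0 //.
exact: leq_ltn_trans cm.
Qed.

Lemma sorted_key_row m r : sorted leq r -> sorted ltn (key_row m r).
Proof.
move=> sr; apply/(sortedP 0) => c; rewrite size_mkseq => hc.
rewrite !nth_mkseq ?(ltnW hc) //.
have := sortedP 0 sr c hc => le.
by rewrite addnS /= ltnS leq_add2r leq_mul2r le orbT.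
Qed.

Lemma column_key m (U : tableau) j :
  column (map (key_row m) U) j = [seq u * m + j | u <- column U j].
Proof.
rewrite /column; elim: U => //= r U IH; rewrite size_mkseq.
by case: ifP => // hj /=; rewrite IH nth_mkseq.
Qed.

Lemma count_mem_key_row m r x :
  size r <= m -> sorted leq r ->
  count_mem x (key_row m r) =
    (x %% m < size r) && (nth 0 (key_row m r) (x %% m) == x).
Proof.
move=> rm sr; rewrite count_uniq_mem; last first.
  by apply: sorted_uniq (sorted_key_row _ _ sr); [apply: ltn_trans | apply: ltnn].
congr nat_of_bool; apply/mapP/andP => [[c] | [hc /eqP Ex]].
  rewrite mem_iota /= add0n => hc ->.
  by rewrite modnMDl modn_small ?nth_mkseq ?(leq_trans hc).
by exists (x %% m); rewrite ?mem_iota // -{1}Ex nth_mkseq.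
Qed.

(** A key determines its column as the remainder modulo [m], so all its occurrences lie in that one
    column. Distinctness of all keys thus reduces to distinctness within columns. *)
Lemma count_mem_key m (U : tableau) x :
  (forall r, r \in U -> size r <= m) -> (forall r, r \in U -> sorted leq r) ->
  count_mem x (flatten (map (key_row m) U)) =
    count_mem x (column (map (key_row m) U) (x %% m)).
Proof.
elim: U => //= r U IH hm hs.
have rU : r \in r :: U by rewrite mem_head.
have sub q : q \in U -> q \in r :: U by rewrite inE orbC => ->.
rewrite count_cat count_mem_key_row ?hm ?hs // IH => [|q /sub /hm //|q /sub /hs //].
by rewrite /column /= size_mkseq; case: ifP.
Qed.

Lemma count_content_le alpha U i :
  has_content alpha U -> i <= size alpha ->
  count (leq^~ i) (flatten U) = psum alpha i.
Proof.
case=> pos cnt; elim: i => [|i IH] hi.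
  rewrite /psum take0 /=; apply/eqP; rewrite -leqn0 leqNgt -has_count.
  by apply/hasPn => x /pos; lia.
rewrite psumS -IH ?(ltnW hi) // -(cnt i.+1) // -count_predUI addnC.
rewrite (@eq_count _ (predI _ _) pred0) ?count_pred0 ?add0n => [|x /=]; last lia.
by apply: eq_count => x /=; lia.
Qed.

Lemma SYT_standardization mu alpha U :
  SSYT mu alpha U ->
  exists2 T : tableau, SYT mu alpha T & Sa_tab alpha T = U.
Proof.
move=> [shU contU rowU colU].
(* The number of cells bounds every row length, so column indices are valid remainders modulo
   [m]. *)
pose m := size (flatten U); pose K := map (key_row m) U.
pose T := map (map (rank (flatten K))) K.
have hm r : r \in U -> size r <= m.
  move=> rU; rewrite /m size_flatten sumnE big_map.
  by rewrite (big_rem r rU) leq_addr.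
have KU : map (map (divn^~ m)) K = U.
  rewrite -map_comp -[RHS]map_id; apply/eq_in_map => r rU /=.
  exact: key_rowK _ _ (hm r rU).
have colK j : sorted ltn (column K j).
  rewrite column_key.
  (* Multiplication by [m] is strictly monotone only for positive [m]; when [m] is 0 there are no
     cells and the column is empty. *)
  case: (posnP m) => [m0|m0].
    suff -> : column U j = [::] by [].
    apply/eqP; rewrite -size_eq0 -leqn0 leqNgt -has_predT; apply/hasP.
    by case=> x /mem_column; rewrite (size0nil m0).
  apply: homo_sorted (colU j) => x y xy.
  by rewrite /= ltn_add2r ltn_pmul2r.
have uK : uniq (flatten K).
  apply: count_mem_uniq => x; case: (boolP (x \in _)) => [hx | /count_memPn //].
  move: (hx); rewrite -has_pred1 has_count.
  rewrite count_mem_key // count_uniq_mem; first by case: (_ \in _).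
  by apply: sorted_uniq (colK _); [apply: ltn_trans | apply: ltnn].
have Sa_rank k : k \in flatten K -> Sa alpha (rank (flatten K) k) = k %/ m.
  move=> kK.
  have hU : k %/ m \in flatten U.
    by rewrite -KU -map_flatten; apply: map_f.
  have hu := contU.1 _ hU.
  have cntK i : i <= size alpha ->
      count (fun y => y %/ m <= i) (flatten K) = psum alpha i.
    by move=> hi; rewrite -(count_content_le _ _ _ contU hi) -KU -map_flatten count_map.
  (* With [i] the entry of the key [k], all keys of entries below [i] are smaller than [k], and all
     keys up to [k] have entries at most [i]. Counting both families places the rank of [k] in block
     [i]. *)
  apply/eqP; rewrite Sa_block // /block -!cntK; try lia.
  apply/andP; split.
    apply: leq_ltn_trans (count_lt_rank _ _ kK); apply: sub_count => y /= hy.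
    by rewrite ltnNge; apply/negP => /(leq_div2r m); lia.
  by apply: sub_count => y /= /(leq_div2r m).
have TU : Sa_tab alpha T = U.
  rewrite -KU /Sa_tab -map_comp; apply/eq_in_map => r rK /=.
  rewrite -map_comp; apply/eq_in_map => k kr /=; apply: Sa_rank.
  by apply/flattenP; exists r.
exists T => //; split; last first.
  (* Labels of block [i] in a column of [T] correspond to entries [i] in the same column of [U],
     which is strictly increasing. *)
  move=> i j hi; rewrite -count_Sa_block // -column_map.
  rewrite -/(Sa_tab alpha T) TU count_uniq_mem ?leq_b1 //.
  by apply: sorted_uniq (colU j); [apply: ltn_trans | apply: ltnn].
have shT : shape T = mu by rewrite -shU -TU [RHS]shape_map.
split=> // [|r|j].
- by rewrite -shT -size_flatten -map_flatten size_map perm_rank.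
- case/mapP=> q qK ->; apply: sorted_rank => [x xq|].
    by apply/flattenP; exists q.
  by case/mapP: qK => p pU ->; apply: sorted_key_row _ _ (rowU p pU).
- by rewrite column_map; apply: sorted_rank _ _ _ (colK j); apply: mem_column.
Qed.

Theorem proposition2p3 (n : nat) (mu alpha : seq nat)
    (hmu : is_partition n mu) (halpha : is_composition n alpha) :
  (forall T : tableau, SYT mu alpha T -> SSYT mu alpha (Sa_tab alpha T)) /\
  (forall U : tableau, SSYT mu alpha U ->
     exists2 T : tableau, SYT mu alpha T & Sa_tab alpha T = U).
Proof.
case: hmu halpha => _ _ Emu [_ Ea].
split=> [T | U]; first by apply: SSYT_Sa_tab; rewrite Emu Ea.
exact: SYT_standardization.
Qed.
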